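(* Let $G>0$ and let $W:GL_+(3,\mathbb{R})\to\mathbb{R}$ be a strain-energy function as described in the context (continuously differentiable, objective, isotropic, homogeneous of degree $-1$), and let $g:(0,\infty)\to\mathbb{R}$ be the associated function defined in the context. Assume furthermore that $g$ is $C^3$ and that \[ g''(1) \ge 50\Big(50 + \sup_{|y-1|\le \frac12} |g'''(y)|\Big). \] Then there exists $\mu_0>0$ such that for every $\mu\in[-\mu_0,\mu_0]$ there exist $\bar\rho>0$ and a classical solution $\varphi:[0,1]\to[0,\infty)$, twice differentiable with $\varphi(0)=\varphi''(0)=0$ and $\varphi'>0$ on $[0,1]$, of the system \[ \begin{cases} \displaystyle \frac{\varphi^2}{R^5}\,\partial_R\Big(\frac{R^4}{\varphi}\,g'(y)\Big) + \frac{\varphi}{R^2}\,g(y) = \Big(\frac{4\pi}{3}G\bar\rho + \mu\,\lambda^3\Big)\bar\rho^{-\frac13}\,\varphi, \\[2mm] g'(y(1)) = 0,\qquad \varphi(1)=1, \end{cases} \] where \[ \lambda(R)=\begin{cases}\varphi(R)/R, & R\in(0,1],\\ \varphi'(0), & R=0,\end{cases}\qquad y(R)=\frac{\varphi'(R)}{\lambda(R)},\quad R\in[0,1]. \]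
   Context: Setting: $G>0$ is Newton's gravitational constant, $\mathcal{B}=\{X\in\mathbb{R}^3:|X|\le1\}$ is the reference domain, and $\bar\rho>0$ is a (constant) reference density. $GL_+(3,\mathbb{R})$ denotes the real $3\times3$ matrices with positive determinant and $SO(3,\mathbb{R})$ the rotations. The strain-energy function $W:GL_+(3,\mathbb{R})\to\mathbb{R}$ is continuously differentiable and satisfies: objectivity $W(OF)=W(F)$ and isotropy $W(FO)=W(F)$ for all $F\in GL_+(3,\mathbb{R})$, $O\in SO(3,\mathbb{R})$; homogeneity of degree $-1$: $W(\sigma F)=\sigma^{-1}W(F)$ for $\sigma>0$; and the normalization $W(I)=\bar\rho^{1/3}$. For $y>0$ and a unit vector $\omega\in\mathbb{S}^2$, the quantity $W(I+(y-1)\,\omega\otimes\omega)$ is independent of $\omega$ (by objectivity and isotropy), and one defines $g(y)=\bar\rho^{-1/3}\,W(I+(y-1)\,\omega\otimes\omega)$. In this setting (with the Piola–Kirchhoff stress $\bar\rho\,\partial W/\partial F$ continuously differentiable in the material variable), $g(1)=1$ and $g'(1)=-\tfrac13$. The displayed system is the equation for the spatial profile $\varphi$ of separable (homologous) spherically symmetric solutions $x(t,X)=q(t)\varphi(|X|)\,X/|X|$ of the equations of motion of a self-gravitating hyperelastic body with traction-free boundary, with $q$ solving $q^2\ddot q=\mu$, $q(0)=1$. *)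

(* Defs.v *)
From HB Require Import structures.
From mathcomp Require Import all_boot all_order all_algebra.
From mathcomp Require Import all_classical all_reals all_analysis.
Set Implicit Arguments. Unset Strict Implicit. Unset Printing Implicit Defensive.
Import Order.TTheory GRing.Theory Num.Theory.
Import numFieldNormedType.Exports.
Local Open Scope classical_set_scope.
Local Open Scope ring_scope.

Section Defs.
Variable R : realType.

Definition is_rotation (O : 'M[R]_3) : Prop :=
  O *m O^T = 1%:M /\ \det O = 1.

Definition C1_on_GLplus (W : 'M[R]_3 -> R) : Prop :=
  forall F : 'M[R]_3, 0 < \det F ->
    differentiable W F /\
    forall i j : 'I_3, {for F, continuous (fun M => 'D_(delta_mx i j) W M)}.

Definition objective (W : 'M[R]_3 -> R) : Prop :=
  forall F O : 'M[R]_3, 0 < \det F -> is_rotation O -> W (O *m F) = W F.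

Definition isotropic (W : 'M[R]_3 -> R) : Prop :=
  forall F O : 'M[R]_3, 0 < \det F -> is_rotation O -> W (F *m O) = W F.

Definition homogeneous_m1 (W : 'M[R]_3 -> R) : Prop :=
  forall (s : R) (F : 'M[R]_3), 0 < s -> 0 < \det F -> W (s *: F) = s^-1 * W F.

Definition e1 : 'rV[R]_3 := delta_mx 0 0.
Definition outer (w : 'rV[R]_3) : 'M[R]_3 := w^T *m w.

(* g(y) = W(I + (y-1) omega (x) omega) for the normalized energy W (W(I)=1) *)
Definition g_of (W : 'M[R]_3 -> R) (y : R) : R :=
  W (1%:M + (y - 1) *: outer e1).

Definition C3_pos (g : R -> R) : Prop :=
  forall y : R, 0 < y ->
    derivable g y 1 /\ derivable (derive1 g) y 1 /\ derivable (derive1n 2 g) y 1 /\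
    {for y, continuous (derive1n 3 g)}.

Definition lam (phi : R -> R) (r : R) : R :=
  if r == 0 then derive1 phi 0 else phi r / r.

Definition yfun (phi : R -> R) (r : R) : R := derive1 phi r / lam phi r.

Definition flux (g phi : R -> R) (r : R) : R :=
  r ^+ 4 / phi r * derive1 g (yfun phi r).

End Defs.

(* Main.v *)
Require Import Defs.
From HB Require Import structures.
From mathcomp Require Import all_boot all_order all_algebra fingroup perm.
From mathcomp Require Import all_classical all_reals all_analysis.
From mathcomp Require Import ring lra.
Import Order.TTheory GRing.Theory Num.Theory.
Import numFieldNormedType.Exports.
Local Open Scope classical_set_scope.
Local Open Scope ring_scope.

(** Write [phi = r l] and [phi' = l y]. With [h y = (4 - y) g' y + g y], for
    which [h' y = (4 - y) g'' y] and [h 1 = 0], the equation becomes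
    [r g''(y) y' = a r^2 - h y] and [r l' = l (y - 1)], where
    [a = A + B l^3], [A = kappa rho^(2/3)], [B = mu rho^(-1/3)] and
    [kappa = 4 pi G / 3].  Substituting [h y = r^2 k] gives
    [(r^5 k)' = r^4 (3 a - (y - 1) (a - k))], that is
    [k = 3 A / 5 + N] with [N r = r^-5 \int_0^r s^4 (3 B l^3 - (y - 1) (a - k))].
    The bound on [g''(1)] makes [h' >= 6000] on [[1/2, 3/2]], so that
    [y - 1 = psi (r^2 k)] with [psi] of Lipschitz constant [1/6000], and [N] is
    nearly constant when [mu] is small.  The traction-free condition reads
    [k 1 = h ys], where [g' ys = 0]; eliminating [A] through it yields
    [k = h ys + N - N 1], [A = 5/3 (h ys - N 1)] and
    [l = 1 + \int_1^r l (y - 1) / s], a contraction in the triple [(k, l, A)].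
    Finally [rho] is read off from [A].  Working on [[-2, 2]] rather than
    [[0, 1]] provides the two-sided derivatives at [0] and [1]. *)

(** * Primitives and weighted averages *)

Section RealFunctions.
Context {R : realType}.
Implicit Types (f g F G : R -> R) (a b x r C : R).

Lemma is_derive_continuous {f x} {d : R} :
  is_derive x 1 f d -> {for x, continuous f}.
Proof.
by move=> [df _]; apply/differentiable_continuous/derivable1_diffP.
Qed.

Lemma is_derive_continuous_within {f} {d : R -> R} {a b} :
  (forall x, a <= x <= b -> is_derive x 1 f (d x)) ->
  {within `[a, b], continuous f}.
Proof.
move=> df; apply: continuous_in_subspaceT => x /[!inE] /= /[!in_itv] /= xab.
exact: is_derive_continuous (df _ xab).
Qed.

Lemma derive_lower_bound {F f} {a b m : R} : a <= b ->
  (forall x, a <= x <= b -> is_derive x 1 F (f x)) ->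
  (forall x, a <= x <= b -> m <= f x) -> m * (b - a) <= F b - F a.
Proof.
move=> ab dF mf.
have dF' x : x \in `]a, b[ -> is_derive x 1 F (f x).
  by rewrite in_itv /= => /andP[ax xb]; apply: dF; rewrite !ltW.
have [c cab ->] := MVT_segment ab dF' (is_derive_continuous_within dF).
by rewrite ler_wpM2r ?subr_ge0//; apply: mf; rewrite in_itv in cab.
Qed.

(** [G - F] and [G + F] both have nonnegative derivatives. A bound that varies with [x] keeps the
    weight [x ^+ 4] in the later estimates of [avg]. *)
Lemma derive_dominated {F G f g} {a b} : a <= b ->
  (forall x, a <= x <= b -> is_derive x 1 F (f x)) ->
  (forall x, a <= x <= b -> is_derive x 1 G (g x)) ->
  (forall x, a <= x <= b -> `|f x| <= g x) ->
  `|F b - F a| <= G b - G a.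
Proof.
move=> ab dF dG fg.
have sub : 0 * (b - a) <= (G - F) b - (G - F) a.
  apply: (@derive_lower_bound _ (fun x => g x - f x)) => // x xab.
    by apply: is_deriveB; [exact: dG|exact: dF].
  by have := fg _ xab; rewrite ler_norml subr_ge0 => /andP[].
have add : 0 * (b - a) <= (G + F) b - (G + F) a.
  apply: (@derive_lower_bound _ (fun x => g x + f x)) => // x xab.
    by apply: is_deriveD; [exact: dG|exact: dF].
  by have := fg _ xab; rewrite ler_norml => /andP[]; lra.
move: sub add; rewrite !fctE mul0r ler_norml; lra.
Qed.

Lemma derive_bounded {F f} {a b C} : a <= b ->
  (forall x, a <= x <= b -> is_derive x 1 F (f x)) ->
  (forall x, a <= x <= b -> `|f x| <= C) ->
  `|F b - F a| <= C * (b - a).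
Proof.
move=> ab dF fC; rewrite mulrBr.
apply: (@derive_dominated _ (fun x => C * x) _ (fun=> C)) ab dF _ fC => x _.
have -> : (fun x : R => C * x) = C \*: (@id R) by [].
by apply: is_derive_eq; rewrite /GRing.scale /= mulr1.
Qed.

Lemma antiderivative f a b : continuous f ->
  exists F, forall x, a < x < b -> is_derive x 1 F (f x).
Proof.
move=> cf; exists (fun x => \int[lebesgue_measure]_(t in [set` `[a, x]]) f t).
move=> x /andP[ax xb].
have intf : lebesgue_measure.-integrable `[a, b] (EFin \o f).
  apply: continuous_compact_integrable; first exact: segment_compact.
  exact: continuous_subspaceT.
have [dF F'] := @continuous_FTC1_closed R f a x b xb intf ax (cf x).
by split=> //; rewrite -derive1E.
Qed.

(* The interval only has to contain [[-2, 2]], the range of [clamp 2]. *)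
Definition prim f : R -> R :=
  get [set F : R -> R | forall x, -3 < x < 3 -> is_derive x 1 F (f x)].

Lemma is_derive_prim f : continuous f ->
  forall x, -3 < x < 3 -> is_derive x 1 (prim f) (f x).
Proof.
move=> cf; have [F dF] := antiderivative f (-3) 3 cf.
exact: (@getPex _ [set F : R -> R | forall x, -3 < x < 3 ->
  is_derive x 1 F (f x)] (ex_intro _ F dF)).
Qed.

(* The value [f 0 / 5] at [0] makes this [\int_0^1 t^4 f (t r) dt]. *)
Definition avg f r : R :=
  if r == 0 then f 0 / 5 else
  (prim (fun s => s ^+ 4 * f s) r - prim (fun s => s ^+ 4 * f s) 0) / r ^+ 5.

Lemma is_derive_pow5 C x :
  is_derive x 1 (fun r => C / 5 * r ^+ 5) (C * x ^+ 4).
Proof.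
have -> : (fun r : R => C / 5 * r ^+ 5) = (C / 5) \*: ((@id R) ^+ 5).
  by apply/funext => r; rewrite !fctE.
by apply: is_derive_eq; rewrite /GRing.scale /=; field.
Qed.

Lemma continuous_pow4M f : continuous f ->
  continuous (fun s : R => s ^+ 4 * f s).
Proof.
move=> cf x; apply: (@continuousM _ _ (fun s : R => s ^+ 4)); last exact: cf.
exact: exprn_continuous.
Qed.

(** Comparison with [C / 5 * x ^+ 5] on [[0, r]] or [[r, 0]]. Bounding [f] only where [|x| <= |r|]
    is what later gives continuity of [avg] at 0. *)
Lemma pow5_dominated {F f C r} : -3 < r < 3 ->
  (forall x, -3 < x < 3 -> is_derive x 1 F (x ^+ 4 * f x)) ->
  (forall x, `|x| <= `|r| -> `|f x| <= C) ->
  `|F r - F 0| <= C / 5 * `|r| ^+ 5.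
Proof.
move=> r3 dF fC.
have dom x : `|x| <= `|r| -> `|x ^+ 4 * f x| <= C * x ^+ 4.
  move=> xr; rewrite normrM mulrC [`|_ ^+ _|]ger0_norm ?exprn_even_ge0//.
  by rewrite ler_wpM2r ?exprn_even_ge0 ?fC.
have [r0|r0] := leP 0 r.
  rewrite [`|r|]ger0_norm//; have := @derive_dominated F (fun r => C / 5 * r ^+ 5)
    (fun x => x ^+ 4 * f x) (fun x => C * x ^+ 4) 0 r r0.
  rewrite (expr0n _ 5) mulr0 subr0; apply.
  - by move=> x /andP[x0 xr]; apply: dF; lra.
  - by move=> x _; exact: is_derive_pow5.
  - by move=> x /andP[x0 xr]; apply: dom; rewrite !ger0_norm.
have := @derive_dominated F (fun r => C / 5 * r ^+ 5)
  (fun x => x ^+ 4 * f x) (fun x => C * x ^+ 4) r 0 (ltW r0).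
rewrite (expr0n _ 5) mulr0 sub0r distrC [`|r|]ltr0_norm// exprNn -signr_odd /= expr1.
rewrite mulN1r mulrN; apply.
- by move=> x /andP[rx x0]; apply: dF; lra.
- by move=> x _; exact: is_derive_pow5.
- by move=> x /andP[rx x0]; apply: dom; rewrite !ler0_norm//; lra.
Qed.

Lemma pow5_avg f r : r ^+ 5 * avg f r =
  prim (fun s => s ^+ 4 * f s) r - prim (fun s => s ^+ 4 * f s) 0.
Proof.
rewrite /avg; case: eqVneq => [->|r0]; last by rewrite mulrC divfK// expf_neq0.
by rewrite expr0n mul0r subrr.
Qed.

Lemma is_derive_pow5_avg f r : continuous f -> -3 < r < 3 ->
  is_derive r 1 (fun x => x ^+ 5 * avg f x) (r ^+ 4 * f r).
Proof.
move=> cf r3; under eq_fun do rewrite pow5_avg.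
have dP := is_derive_prim _ (continuous_pow4M _ cf) r r3.
rewrite -[X in is_derive _ _ _ X]subr0; exact: is_deriveB.
Qed.

Lemma avg_dist f g C r : continuous f -> continuous g -> -3 < r < 3 ->
  (forall x, `|x| <= `|r| -> `|f x - g x| <= C) ->
  `|avg f r - avg g r| <= C / 5.
Proof.
move=> cf cg r3 fgC.
have [r0|r0] := eqVneq r 0.
  have fg0 := fgC 0; rewrite normr0 normr_ge0 in fg0.
  rewrite /avg r0 eqxx -mulrBl normrM [`|5^-1|]ger0_norm// ler_wpM2r//.
  exact: fg0.
have rp : 0 < `|r| ^+ 5 by rewrite exprn_gt0 ?normr_gt0.
rewrite -(ler_pM2r rp) -normrX -normrM mulrC mulrBr !pow5_avg normrX.
set F := prim _; set G := prim _.
have -> : F r - F 0 - (G r - G 0) = (F - G) r - (F - G) 0 by rewrite !fctE; ring.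
apply: pow5_dominated r3 _ fgC => x x3; rewrite mulrBr.
have := is_derive_prim _ (continuous_pow4M _ cf) x x3.
have := is_derive_prim _ (continuous_pow4M _ cg) x x3.
by move=> dG dF; apply: is_deriveB.
Qed.

(** [prim] is a chosen primitive, known only through its derivative, so even this value rests on
    uniqueness: the primitive minus [C / 5 * x ^+ 5] has derivative 0. *)
Lemma avg_cst C r : -3 < r < 3 -> avg (fun=> C) r = C / 5.
Proof.
move=> r3; have [->|r0] := eqVneq r 0; first by rewrite /avg eqxx.
have rp : r ^+ 5 != 0 by rewrite expf_neq0.
apply: (mulfI rp); rewrite pow5_avg; set F := prim _.
have := @pow5_dominated (F - (fun r => C / 5 * r ^+ 5)) (fun=> 0) 0 r r3.
rewrite !fctE [0 ^+ _]expr0n mulr0 subr0 mul0r mul0r => H.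
suff : `|F r - C / 5 * r ^+ 5 - F 0| <= 0.
  by rewrite normr_le0 => /eqP ?; lra.
apply: H => [x x3|x _]; last by rewrite normr0.
have -> : x ^+ 4 * 0 = x ^+ 4 * C - C * x ^+ 4 by ring.
have cC : continuous (fun _ : R => C) by move=> z; exact: cvg_cst.
have := is_derive_prim _ (continuous_pow4M _ cC) x x3.
have := is_derive_pow5 C x.
by move=> dG dF; apply: is_deriveB.
Qed.

Lemma avg_bounded f C r : continuous f -> -3 < r < 3 ->
  (forall x, `|f x| <= C) -> `|avg f r| <= C / 5.
Proof.
move=> cf r3 fC; have cst0 : avg (fun=> 0) r = 0 by rewrite avg_cst ?mul0r.
rewrite -[avg f r]subr0 -cst0; apply: avg_dist => // [x|x _].
  exact: cst_continuous.
by rewrite subr0.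
Qed.

(** Away from 0 this is a quotient of continuous functions. At 0, [f] is compared with the constant
    [f 0] on shrinking intervals. *)
Lemma avg_continuous f r : continuous f -> -3 < r < 3 ->
  {for r, continuous (avg f)}.
Proof.
move=> cf r3; have [r0|r0] := eqVneq r 0; last first.
  have d := is_derive_continuous (is_derive_pow5_avg _ _ cf r3).
  have dV : {for r, continuous (fun x : R => (x ^+ 5)^-1)}.
    by apply: continuousV; [rewrite expf_neq0|exact: exprn_continuous].
  have h : (fun x => x ^+ 5 * avg f x * x ^- 5) x @[x --> r] --> avg f r.
    have -> : avg f r = r ^+ 5 * avg f r * r ^- 5.
      by rewrite [RHS]mulrC mulKf ?expf_neq0.
    exact: (cvgM d dV).
  apply: cvg_trans h.
  apply: near_eq_cvg; near=> x; rewrite mulrC mulKf// expf_neq0//.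
  near: x; exact: (cvgr_neq0 _ cvg_id r0).
rewrite r0 in r3 *; apply/cvgrPdist_le => e e0.
have /cvgrPdist_le /(_ _ e0) := cf 0.
case/nbhs_ballP => d /= d0 dP; near=> x.
have x3 : -3 < x < 3.
  near: x; apply: (near_in_itvoo r3).
have xd : `|x| < d.
  near: x; apply/nbhs_ballP; exists d => // z.
  by rewrite /ball /= sub0r normrN.
have -> : avg f 0 = avg (fun=> f 0) x by rewrite avg_cst// /avg eqxx.
apply: (@le_trans _ _ (e / 5)); last lra.
apply: avg_dist => // [|y yx]; first exact: cst_continuous.
apply: dP; rewrite /ball /= sub0r normrN; exact: le_lt_trans yx xd.
Unshelve. all: by end_near.
Qed.
End RealFunctions.

(** * A contraction principle for the uniform distance *)

Section Contraction.
Context {R : realType}.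

Lemma pow2_arbitrarily_small (D e : R) : 0 < e ->
  exists n, D / 2 ^+ n <= e.
Proof.
move=> e0; have [D0|D0] := leP D 0.
  by exists 0%N; rewrite expr0 divr1 (le_trans D0) ?ltW.
have De : 0 <= D / e by rewrite divr_ge0 ?ltW.
exists (Num.bound (D / e)); set n := Num.bound _.
have n2 : n%:R <= 2 ^+ n :> R.
  by have /ltnW := ltn_expl n (isT : (1 < 2)%N); rewrite -(ler_nat R) natrX.
have := le_trans (ltW (archi_boundP De)) n2.
by rewrite !ler_pdivrMr ?exprn_gt0// mulrC.
Qed.

(** Banach's principle on a bare index type, with pointwise bounds in place of a sup norm; a triple
    of two functions and a number then fits as one function on a sum type. The iterates converge
    pointwise by completeness of [R], and uniformly by the geometric bound. *)
Lemma uniform_half_contraction (I : Type) (P : set (I -> R))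
    (T : (I -> R) -> I -> R) (x0 : I -> R) (D : R) :
  P x0 -> (forall x, P x -> P (T x)) ->
  (forall x, (forall e : R, 0 < e -> exists2 z, P z & forall i, `|z i - x i| <= e)
    -> P x) ->
  (forall i, `|T x0 i - x0 i| <= D) ->
  (forall x y (d : R), P x -> P y -> (forall i, `|x i - y i| <= d) ->
    forall i, `|T x i - T y i| <= d / 2) ->
  exists2 x, P x & forall i, T x i = x i.
Proof.
move=> Px0 PT Pcl TD Tc; pose u n := iter n T x0.
have Pu n : P (u n) by elim: n => //= n; exact: PT.
have uS n : forall i, `|u n.+1 i - u n i| <= D / 2 ^+ n.
  elim: n => [i|n IH i]; first by rewrite expr0 divr1; exact: TD.
  by rewrite exprSr invfM mulrA; apply: (Tc _ _ _ (Pu n.+1) (Pu n)).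
(* The subtracted tail lets the induction close: the step [D / 2 ^+ (n + m)] is exactly the decrease
   of [2 * D / 2 ^+ (n + m)]. *)
have uD n m i : `|u (n + m)%N i - u n i| <= 2 * D / 2 ^+ n - 2 * D / 2 ^+ (n + m).
  elim: m => [|m IH]; first by rewrite addn0 !subrr normr0.
  have -> : u (n + m.+1)%N i - u n i =
    (u (n + m).+1 i - u (n + m)%N i) + (u (n + m)%N i - u n i).
    by rewrite addnS; ring.
  apply: le_trans (ler_normD _ _) _; apply: le_trans (lerD (uS _ i) IH) _.
  rewrite addnS (exprSr _ (n + m)) invfM.
  by set b := _ ^- _; lra.
(* The sign of [D] is available only at an index: nothing constrains [D] when [I] is empty. *)
have i0 (i : I) : 0 <= D by apply: le_trans (TD i); exact: normr_ge0.
have uE n m i : (n <= m)%N -> `|u m i - u n i| <= 2 * D / 2 ^+ n.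
  move=> /subnKC <-; apply: le_trans (uD _ _ _) _.
  rewrite gerBl mulr_ge0 ?invr_ge0 ?exprn_ge0// mulr_ge0//; exact: i0 i.
have cu i : cvgn (fun n => u n i).
  apply/cauchy_cvgP/cauchy_exP => e e0.
  have [n ne] := pow2_arbitrarily_small (2 * D) (e / 2) (divr_gt0 e0 (ltr0Sn _ _)).
  exists (u n i); exists n => // m /= nm; rewrite /ball /= distrC.
  apply: le_lt_trans (uE _ _ _ nm) (le_lt_trans ne _).
  by rewrite ltr_pdivrMr// ltr_pMr// ltr1n.
pose x i := limn (fun n => u n i).
have ux n i : `|u n i - x i| <= 2 * D / 2 ^+ n.
  apply/ler_addgt0Pr => e e0.
  have /cvgrPdist_le /(_ _ e0) [N _ NP] := cu i.
  have := NP (maxn n N) (leq_maxr _ _); have := uE n (maxn n N) i (leq_maxl _ _).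
  rewrite -/(x i) [`|_ - u n i|]distrC => h1 h2.
  apply: le_trans (ler_distD (u (maxn n N) i) _ _) _.
  by rewrite lerD// distrC.
have Px : P x.
  apply: Pcl => e e0; have [n ne] := pow2_arbitrarily_small (2 * D) e e0.
  by exists (u n) => // i; apply: le_trans (ux n i) ne.
exists x => // i; apply/eqP; rewrite -subr_eq0 -normr_le0.
apply/ler_addgt0Pr => e e0; rewrite add0r.
have [n ne] := pow2_arbitrarily_small (2 * D) (e / 2) (divr_gt0 e0 (ltr0Sn _ _)).
have := Tc _ _ _ (Pu n) Px (ux n) i; have := ux n.+1 i.
rewrite exprSr invfM mulrA => h1 h2.
apply: le_trans (ler_distD (u n.+1 i) _ _) _; rewrite distrC.
rewrite /= in h1 *; apply: le_trans (lerD h2 h1) _; rewrite -splitr.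
by apply: le_trans ne _; rewrite ler_pdivrMr// ler_peMr ?ltW// ltr1n.
Qed.
End Contraction.

(** * Inverse of a steep function *)

Section Clamp.
Context {R : realType}.
Implicit Types (f g F G : R -> R) (a b x r C : R).

(** For [a >= 0], the 1-Lipschitz retraction of the line onto [[-a, a]]; it extends data given on an
    interval to all of [R]. *)
Definition clamp a x : R := if x <= - a then - a else if a <= x then a else x.

Lemma clamp_id a x : - a <= x <= a -> clamp a x = x.
Proof. by rewrite /clamp => /andP[h1 h2]; case: leP => ?; [|case: leP => ?]; lra. Qed.

Lemma clamp_bound a x : 0 <= a -> - a <= clamp a x <= a.
Proof.
move=> a0; rewrite /clamp.
by have [?|?] := leP x (- a); [|have [?|?] := leP a x]; lra.
Qed.

Lemma clamp_dist a x r : 0 <= a -> `|clamp a x - clamp a r| <= `|x - r|.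
Proof.
move=> a0; wlog xr : x r / x <= r.
  move=> W; have [/W //|/ltW /W] := leP x r.
  by rewrite distrC [`|x - r|]distrC.
suff : 0 <= clamp a r - clamp a x <= r - x.
  rewrite distrC [`|x - r|]distrC => /andP[h1 h2].
  by rewrite !ger0_norm ?subr_ge0// -subr_ge0.
rewrite /clamp.
have [h1|h1] := leP x (- a); [|have [h2|h2] := leP a x];
(have [h3|h3] := leP r (- a); [|have [h4|h4] := leP a r]); lra.
Qed.

Lemma lipschitz_continuous f C :
  (forall x r, `|f x - f r| <= C * `|x - r|) -> continuous f.
Proof.
move=> fL x; apply/cvgrPdist_le => e e0.
have C0 : 0 < `|C| + 1 by rewrite ltr_wpDl.
apply/nbhs_ballP; exists (e / (`|C| + 1)) => /=; first by rewrite divr_gt0.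
move=> r; rewrite /ball /= ltr_pdivlMr// => xr.
apply: le_trans (fL _ _) _; apply: le_trans (ltW xr).
by rewrite mulrC ler_wpM2l// (le_trans (ler_norm _))// lerDl.
Qed.

Lemma clamp_continuous a : 0 <= a -> continuous (clamp a).
Proof.
by move=> a0; apply: (@lipschitz_continuous _ 1) => x r; rewrite mul1r clamp_dist.
Qed.

End Clamp.

Section InverseOfIncreasing.
Context {R : realType}.
Implicit Types (h dh : R -> R) (x y : R).

(** As [h 1 = 0] and [h' >= L], the map [h] expands distances by [L] and its range on [[1/2, 3/2]]
    contains [[-L/2, L/2]]. Clamping the argument to that range makes [psi] total and globally
    Lipschitz. *)
Lemma inverse_at_1 h dh (L : R) : 0 < L ->
  (forall y, 2^-1 <= y <= 3 / 2 -> is_derive y 1 h (dh y)) ->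
  (forall y, 2^-1 <= y <= 3 / 2 -> L <= dh y) ->
  h 1 = 0 ->
  exists psi : R -> R,
  [/\ forall x r, `|psi x - psi r| <= L^-1 * `|x - r|,
      forall x, `|psi x| <= 2^-1,
      forall x, `|x| < L / 2 -> h (1 + psi x) = x,
      forall y, 2^-1 <= y <= 3 / 2 -> `|h y| < L / 2 -> psi (h y) = y - 1
    & forall x, `|x| < L / 2 -> is_derive x 1 psi (dh (1 + psi x))^-1].
Proof.
move=> L0 hd dL h1.
have hinc y z : 2^-1 <= y -> y <= z -> z <= 3 / 2 -> L * (z - y) <= h z - h y.
  move=> y0 yz z0.
  apply: (derive_lower_bound yz) => x /andP[? ?]; [apply: hd|apply: dL]; lra.
have hexp y z : 2^-1 <= y <= 3 / 2 -> 2^-1 <= z <= 3 / 2 ->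
    L * `|y - z| <= `|h y - h z|.
  move=> /andP[? ?] /andP[? ?].
  have [yz|/ltW zy] := leP y z.
    rewrite distrC ger0_norm ?subr_ge0// distrC.
    by apply: le_trans (hinc _ _ _ yz _) (ler_norm _).
  rewrite ger0_norm ?subr_ge0//.
  by apply: le_trans (hinc _ _ _ zy _) (ler_norm _).
have hsurj x : - (L / 2) <= x <= L / 2 ->
    exists y, 2^-1 <= y <= 3 / 2 /\ h y = x.
  move=> /andP[xl xr].
  have lo : h 2^-1 <= x by have := hinc 2^-1 1; rewrite h1; lra.
  have hi : x <= h (3 / 2) by have := hinc 1 (3 / 2); rewrite h1; lra.
  have [|||y yI yx] := @IVT R h 2^-1 (3 / 2) x.
  - by lra.
  - exact: (is_derive_continuous_within hd).
  - by rewrite ge_min le_max lo hi orbT.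
  by exists y; split => //; rewrite in_itv in yI.
have L2 : 0 <= L / 2 by lra.
have /choice[p pP] : forall x, exists y, 2^-1 <= y <= 3 / 2 /\
    h y = clamp (L / 2) x.
  by move=> x; apply/hsurj/clamp_bound.
pose psi x := p x - 1.
have psiL x r : `|psi x - psi r| <= L^-1 * `|x - r|.
  rewrite ler_pdivlMl//.
  have [px hx] := pP x; have [pr hr] := pP r.
  have -> : psi x - psi r = p x - p r by rewrite /psi; ring.
  by apply: le_trans (hexp _ _ px pr) _; rewrite hx hr clamp_dist.
have hpsi x : `|x| < L / 2 -> h (1 + psi x) = x.
  move=> xL; rewrite /psi addrC subrK (pP x).2 clamp_id//.
  by move: xL; rewrite ltr_norml => /andP[? ?]; rewrite !ltW.
have psih y : 2^-1 <= y <= 3 / 2 -> `|h y| < L / 2 -> psi (h y) = y - 1.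
  move=> yI hy; have := hexp _ _ (pP (h y)).1 yI.
  have -> : h (p (h y)) = h y.
    by have := hpsi _ hy; rewrite /psi addrC subrK.
  rewrite subrr normr0 pmulr_rle0// normr_le0 subr_eq0 => /eqP ph.
  by rewrite /psi ph.
exists psi; split => // [x|x xL].
  by rewrite /psi ler_norml; have := (pP x).1; lra.
have xabs : `|h (1 + psi x)| < L / 2 by rewrite hpsi.
have psix := (pP x).1.
have yx : 1 + psi x = p x by rewrite /psi addrC subrK.
have psi0 : psi 0 = 0 by rewrite -h1 psih ?subrr ?h1 ?normr0 ?divr_gt0//; lra.
(* The strict bound on [x] and the Lipschitz estimate put [p x] strictly inside the interval, so
   that the facts about [h] hold on a neighbourhood of it. *)
have ylt : 2^-1 < p x < 3 / 2.
  have := psiL x 0; rewrite psi0 !subr0 ler_pdivlMl// => h2.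
  have : `|psi x| < 2^-1 by rewrite -(ltr_pM2l L0); apply: le_lt_trans h2 _.
  by rewrite ltr_norml /psi; lra.
have hC : {for p x, continuous h} by apply: is_derive_continuous (hd _ psix).
suff key : is_derive (h (p x)) 1 (fun z => 1 + psi z) (dh (p x))^-1.
  have hpx : h (p x) = x by rewrite -yx hpsi.
  rewrite hpx in key; rewrite yx.
  have -> : psi = (fun z => 1 + psi z) - cst 1.
    by apply/funext => z; rewrite !fctE addrC addKr.
  rewrite -[X in is_derive _ _ _ X]subr0; exact: is_deriveB.
rewrite -yx in ylt hC psix *.
have nearI : \forall y \near 1 + psi x, 2^-1 <= y <= 3 / 2.
  have yI : 1 + psi x \in `]2^-1, 3 / 2[ by rewrite in_itv.
  by apply: filterS (near_in_itvoo yI) => z; rewrite in_itv /=; lra.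
apply: is_derive_inverse.
- near=> y; rewrite psih; first by rewrite addrC subrK.
    by near: y; exact: nearI.
  by near: y; apply: (cvgr_norm_lt _ hC).
- near=> y; apply: is_derive_continuous (hd _ _).
  by near: y; exact: nearI.
- exact: hd.
- by rewrite gt_eqF// (lt_le_trans L0)// dL.
Unshelve. all: by end_near.
Qed.

End InverseOfIncreasing.

(** * The fixed-point problem *)

Section Products.
Context {R : realType}.
Implicit Types x y X Y d : R.

Lemma normM_le x y X Y : `|x| <= X -> `|y| <= Y -> `|x * y| <= X * Y.
Proof. by move=> xX yY; rewrite normrM ler_pM. Qed.

Lemma distM_le x y x' y' X Y dx dy : `|x| <= X -> `|y'| <= Y ->
  `|x - x'| <= dx -> `|y - y'| <= dy -> `|x * y - x' * y'| <= X * dy + dx * Y.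
Proof.
move=> xX yY dX dY.
have -> : x * y - x' * y' = x * (y - y') + (x - x') * y' by ring.
by apply: le_trans (ler_normD _ _) _; rewrite lerD ?normM_le.
Qed.

End Products.

Section PointwiseContinuity.
Context {R : realType}.
Implicit Types (f g : R -> R) (s : R).

Lemma continuous_at_cst (a s : R) : continuous_at s (fun=> a).
Proof. exact: cvg_cst. Qed.

Lemma continuous_atD f g s : continuous_at s f -> continuous_at s g ->
  continuous_at s (fun x => f x + g x).
Proof. exact: continuousD. Qed.

Lemma continuous_atB f g s : continuous_at s f -> continuous_at s g ->
  continuous_at s (fun x => f x - g x).
Proof. exact: continuousB. Qed.

Lemma continuous_atM f g s : continuous_at s f -> continuous_at s g ->
  continuous_at s (fun x => f x * g x).
Proof. exact: continuousM. Qed.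

Lemma continuous_atX f n s : continuous_at s f ->
  continuous_at s (fun x => f x ^+ n).
Proof.
move=> cf; apply: (@continuous_comp _ _ _ f (fun x : R => x ^+ n)) => //.
exact: exprn_continuous.
Qed.

End PointwiseContinuity.

(** * Estimates for the map on triples [(k, l, A)] *)

Section FixedPoint.
Context {R : realType}.
Variables (psi : R -> R) (ks beta : R).
Hypothesis psi_lip : forall x r, `|psi x - psi r| <= 6000^-1 * `|x - r|.
Hypothesis psi0 : psi 0 = 0.
Hypothesis ks_bound : 99 / 100 <= ks <= 101 / 100.
Hypothesis beta_small : `|beta| <= 1000^-1.
Implicit Types (k l : R -> R) (A c r d : R).

(** This is [mu rho^(-1/3)] in terms of [A]: since [rho^(1/3) = sqrt (A / kappa)], [beta] stands for
    [mu sqrt kappa], and the density disappears from the iteration. Likewise [ks] stands for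
    [h ys = g ys]. *)
Let B A := beta / Num.sqrt A.

(** With [a = A + B A l^3] and [y - 1 = psi (c^2 k)], this is [3 a - (y - 1) (a - k)] without its
    term [3 A], whose average is exactly [3 A / 5]. *)
Definition source c (k l A : R) : R :=
  3 * B A * l ^+ 3 - psi (c ^+ 2 * k) * (A + B A * l ^+ 3 - k).

(** The quotient [(y - 1) / r = l' / l]. Division by 0 returns 0, which is the right value at
    [c = 0] because [psi (c^2 k) = O(c^2)]. *)
Definition strain_rate c (k : R) : R := psi (c ^+ 2 * k) / c.

Lemma B_bound A : 3 / 2 <= A -> `|B A| <= 1000^-1.
Proof.
move=> A1; have s1 : 1 <= Num.sqrt A by rewrite -sqrtr1 ler_wsqrtr//; lra.
rewrite /B normrM normfV [`|Num.sqrt A|]ger0_norm ?sqrtr_ge0//.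
rewrite ler_pdivrMr ?(lt_le_trans ltr01)//; apply: le_trans beta_small _.
lra.
Qed.

Lemma B_dist A A' d : 3 / 2 <= A -> 3 / 2 <= A' -> `|A - A'| <= d ->
  `|B A - B A'| <= 1000^-1 * d.
Proof.
move=> A1 A1'; have A0 : 0 <= A by lra. have A0' : 0 <= A' by lra.
have s1 : 1 <= Num.sqrt A by rewrite -sqrtr1 ler_wsqrtr//; lra.
have s1' : 1 <= Num.sqrt A' by rewrite -sqrtr1 ler_wsqrtr//; lra.
rewrite /B -{1}(sqr_sqrtr A0) -{1}(sqr_sqrtr A0').
set a := Num.sqrt A in s1 *; set b := Num.sqrt A' in s1' *.
have a0 : a != 0 by rewrite gt_eqF//; lra.
have b0 : b != 0 by rewrite gt_eqF//; lra.
have -> : a ^+ 2 - b ^+ 2 = (a - b) * (a + b) by ring.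
have -> : beta / a - beta / b = beta * ((b - a) / (a * b)).
  by field; rewrite a0 b0.
rewrite normrM [`|a + b|]ger0_norm; last lra.
move=> hd; apply: normM_le beta_small _.
have ab1 : 1 <= a * b by nra.
rewrite normrM normfV [`|a * b|]ger0_norm ?mulr_ge0//; try lra.
rewrite ler_pdivrMr; last lra.
rewrite distrC; have X0 := normr_ge0 (a - b).
have h2 : `|a - b| * 2 <= `|a - b| * (a + b) by rewrite ler_wpM2l//; lra.
have h3 : d <= d * (a * b) by rewrite ler_peMr//; lra.
lra.
Qed.

Lemma psi_le x : `|psi x| <= 6000^-1 * `|x|.
Proof. by have := psi_lip x 0; rewrite psi0 !subr0. Qed.

Lemma sqr_le4 c : - 2 <= c <= 2 -> `|c ^+ 2| <= 4.
Proof. by move=> c2; rewrite ger0_norm ?sqr_ge0//; nra. Qed.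

Lemma near1_norm (k : R) : `|k - 1| <= 2^-1 -> `|k| <= 3 / 2.
Proof. by rewrite !ler_norml; lra. Qed.

Lemma psi_c2_bound c (k : R) : - 2 <= c <= 2 -> `|k - 1| <= 2^-1 ->
  `|psi (c ^+ 2 * k)| <= 1000^-1.
Proof.
move=> /sqr_le4 c2 /near1_norm k1; apply: le_trans (psi_le _) _.
have := normM_le _ _ _ _ c2 k1; lra.
Qed.

Lemma psi_c2_dist c (k k' d : R) : - 2 <= c <= 2 -> `|k - k'| <= d ->
  `|psi (c ^+ 2 * k) - psi (c ^+ 2 * k')| <= 1000^-1 * d.
Proof.
move=> /sqr_le4 c2 kd; apply: le_trans (psi_lip _ _) _; rewrite -mulrBr.
have d0 : 0 <= d by apply: le_trans kd.
have := normM_le _ _ _ _ c2 kd; lra.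
Qed.

Lemma cube_bound (l : R) : `|l - 1| <= 2^-1 -> `|l ^+ 3| <= 27 / 8.
Proof.
move=> /near1_norm l1; have l2 := normM_le _ _ _ _ l1 l1.
by have := normM_le _ _ _ _ l1 l2; rewrite !exprS expr0 mulr1; lra.
Qed.

Lemma cube_dist (l l' d : R) : `|l - 1| <= 2^-1 -> `|l' - 1| <= 2^-1 ->
  `|l - l'| <= d -> `|l ^+ 3 - l' ^+ 3| <= 7 * d.
Proof.
move=> /near1_norm l1 /near1_norm l1' ld.
have d0 : 0 <= d by apply: le_trans ld.
have sq := distM_le _ _ _ _ _ _ _ _ l1 l1' ld ld.
have l2' := normM_le _ _ _ _ l1' l1'.
have := distM_le _ _ _ _ _ _ _ _ l1 l2' ld sq.
by rewrite !exprS !expr0 !mulr1; lra.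
Qed.

Lemma Bcube_bound A (l : R) : 3 / 2 <= A -> `|l - 1| <= 2^-1 ->
  `|B A * l ^+ 3| <= 4 / 1000.
Proof.
move=> /B_bound b1 /cube_bound l3.
have := normM_le _ _ _ _ b1 l3; lra.
Qed.

Lemma Bcube_dist A A' (l l' d : R) : 3 / 2 <= A -> 3 / 2 <= A' ->
  `|l - 1| <= 2^-1 -> `|l' - 1| <= 2^-1 ->
  `|A - A'| <= d -> `|l - l'| <= d ->
  `|B A * l ^+ 3 - B A' * l' ^+ 3| <= 11 / 1000 * d.
Proof.
move=> A1 A1' l1 l1' Ad ld.
have d0 : 0 <= d by apply: le_trans ld.
have := distM_le _ _ _ _ _ _ _ _ (B_bound _ A1) (cube_bound _ l1')
  (B_dist _ _ _ A1 A1' Ad) (cube_dist _ _ _ l1 l1' ld); lra.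
Qed.

Lemma source_bound c (k l A : R) : - 2 <= c <= 2 ->
  `|k - 1| <= 2^-1 -> `|l - 1| <= 2^-1 -> 3 / 2 <= A <= 2 ->
  `|source c k l A| <= 20^-1.
Proof.
move=> c2 k1 l1 /andP[A1 A2]; rewrite /source.
have v := Bcube_bound _ _ A1 l1.
have p := psi_c2_bound _ _ c2 k1.
have w : `|A + B A * l ^+ 3 - k| <= 4.
  by move: v (near1_norm _ k1); rewrite !ler_norml; lra.
have := normM_le _ _ _ _ p w.
move: v; rewrite !ler_norml; lra.
Qed.

(** The cubic term contributes [3 * 11 / 1000] and the product [3 / 1000 + 4 / 1000], in total
    [40 / 1000] times [d]. *)
Lemma source_dist c (k l A k' l' A' d : R) : - 2 <= c <= 2 ->
  `|k - 1| <= 2^-1 -> `|l - 1| <= 2^-1 -> 3 / 2 <= A <= 2 ->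
  `|k' - 1| <= 2^-1 -> `|l' - 1| <= 2^-1 -> 3 / 2 <= A' <= 2 ->
  `|k - k'| <= d -> `|l - l'| <= d -> `|A - A'| <= d ->
  `|source c k l A - source c k' l' A'| <= 20^-1 * d.
Proof.
move=> c2 k1 l1 /andP[A1 A2] k1' l1' /andP[A1' A2'] kd ld Ad; rewrite /source.
have d0 : 0 <= d by apply: le_trans ld.
have v' := Bcube_bound _ _ A1' l1'.
have dv := Bcube_dist _ _ _ _ _ A1 A1' l1 l1' Ad ld.
have p := psi_c2_bound _ _ c2 k1.
have dp := psi_c2_dist _ _ _ _ c2 kd.
have w : `|A' + B A' * l' ^+ 3 - k'| <= 4.
  by move: v' (near1_norm _ k1'); rewrite !ler_norml; lra.
have dw : `|A + B A * l ^+ 3 - k - (A' + B A' * l' ^+ 3 - k')| <= 3 * d.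
  by move: dv kd Ad; rewrite !ler_norml; lra.
have := distM_le _ _ _ _ _ _ _ _ p w dp dw.
move: dv; rewrite !ler_norml; lra.
Qed.

(** One factor of [c^2] cancels against the denominator; the other is at most 2, which turns
    [1 / 6000] into [1 / 3000]. *)
Lemma rate_div c (x X : R) : - 2 <= c <= 2 -> 0 <= X ->
  `|x| <= 6000^-1 * (`|c ^+ 2| * X) -> `|x / c| <= 3000^-1 * X.
Proof.
move=> c2 X0 xX; have [->|c0] := eqVneq c 0.
  by rewrite invr0 mulr0 normr0; lra.
have cp : 0 < `|c| by rewrite normr_gt0.
rewrite normrM normfV ler_pdivrMr//; apply: le_trans xX _.
rewrite normrX; have : `|c| <= 2 by rewrite ler_norml.
by move=> cle; have : 0 <= `|c| * X; [rewrite mulr_ge0//|nra].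
Qed.

Lemma strain_rate_bound c (k : R) : - 2 <= c <= 2 -> `|k - 1| <= 2^-1 ->
  `|strain_rate c k| <= 2000^-1.
Proof.
move=> c2 /near1_norm k1; have := rate_div c (psi (c ^+ 2 * k)) `|k| c2.
rewrite -normrM => /(_ (normr_ge0 _) (psi_le _)).
rewrite /strain_rate; lra.
Qed.

Lemma strain_rate_dist c (k k' d : R) : - 2 <= c <= 2 -> `|k - k'| <= d ->
  `|strain_rate c k - strain_rate c k'| <= 3000^-1 * d.
Proof.
move=> c2 kd; rewrite /strain_rate -mulrBl.
have d0 : 0 <= d by apply: le_trans kd.
apply: rate_div => //; apply: le_trans (psi_lip _ _) _; rewrite -mulrBr.
by rewrite normrM; have := ler_wpM2l (normr_ge0 (c ^+ 2)) kd; lra.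
Qed.

(** These conditions survive uniform limits, as the contraction principle demands. The window for
    [A] surrounds [5 / 3] and keeps [Num.sqrt A] above 1. *)
Definition admissible k l A : Prop :=
  [/\ continuous k, continuous l, forall r, `|k r - 1| <= 2^-1,
      forall r, `|l r - 1| <= 2^-1 & 3 / 2 <= A <= 2].

Definition src k l A s : R := source (clamp 2 s) (k s) (l s) A.
Definition slope k l s : R := l s * strain_rate (clamp 2 s) (k s).

Lemma psi_continuous : continuous psi.
Proof. exact: lipschitz_continuous psi_lip. Qed.

Lemma clamp2_bound r : - 2 <= clamp 2 r <= 2.
Proof. by apply: clamp_bound. Qed.

Lemma psi_c2_continuous k : continuous k ->
  continuous (fun s => psi (clamp 2 s ^+ 2 * k s)).
Proof.
move=> ck s; apply: continuous_comp; last exact: psi_continuous.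
apply: continuous_atM (ck s); apply: continuous_atX.
exact: clamp_continuous.
Qed.

Lemma src_continuous k l A : admissible k l A -> continuous (src k l A).
Proof.
move=> [ck cl _ _ _] s; rewrite /src /source.
have cl3 (b : R) : continuous_at s (fun x => b * l x ^+ 3).
  by apply: continuous_atM (continuous_at_cst _ _) (continuous_atX _ _ _ (cl s)).
apply: continuous_atB; first exact: cl3.
apply: continuous_atM; first exact: psi_c2_continuous.
apply: continuous_atB (ck s); apply: continuous_atD (cl3 _).
exact: continuous_at_cst.
Qed.

(** Only a zero of [clamp 2] is delicate: near it [psi (c^2 k) / c] is at most [|c| |k| / 6000],
    which tends to the value 0 assigned by division by 0. *)
Lemma slope_continuous k l A : admissible k l A -> continuous (slope k l).
Proof.
move=> [ck cl k1 _ _] s; apply: continuous_atM; first exact: cl.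
have [c0|c0] := eqVneq (clamp 2 s) 0; last first.
  apply: continuous_atM; first exact: psi_c2_continuous.
  by apply: continuousV => //; exact: clamp_continuous.
rewrite /continuous_at {2}/strain_rate c0 invr0 mulr0.
apply/cvgr0Pnorm_le => e e0.
have := @clamp_continuous R 2 (ler0n _ _) s; rewrite /continuous_at c0.
move=> /cvgr0Pnorm_le /(_ _ e0); apply: filterS => r ce.
rewrite /strain_rate; set c := clamp 2 r in ce *.
have [->|cn0] := eqVneq c 0; first by rewrite invr0 mulr0 normr0 ltW.
have cp : 0 < `|c| by rewrite normr_gt0.
rewrite normrM normfV ler_pdivrMr//; apply: le_trans (psi_le _) _.
rewrite normrM normrX; have := near1_norm _ (k1 r).
have : `|c| ^+ 2 <= e * `|c| by rewrite expr2 ler_wpM2r.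
have : 0 <= `|c| ^+ 2 by rewrite sqr_ge0.
set a := `|c|; set b := `|k r|.
move=> h1 h2 h3; have : a ^+ 2 * b <= a ^+ 2 * (3 / 2) by rewrite ler_wpM2l.
lra.
Qed.

(** Subtracting the value at 1 builds both boundary conditions, [k 1 = ks] and [l 1 = 1], into the
    iteration. At a fixed point [newA] makes the constant [ks - avg _ 1] equal to [3 A / 5], which
    restores the integral equation for [k]. *)
Definition newk k l A r : R :=
  ks + avg (src k l A) (clamp 2 r) - avg (src k l A) 1.
Definition newl k l r : R :=
  1 + prim (slope k l) (clamp 2 r) - prim (slope k l) 1.
Definition newA k l A : R := 5 / 3 * (ks - avg (src k l A) 1).

Lemma clamp2_in_domain r : -3 < clamp 2 r < 3.
Proof. by have := clamp2_bound r; lra. Qed.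

Lemma avg_src_bound k l A r : admissible k l A -> -3 < r < 3 ->
  `|avg (src k l A) r| <= 100^-1.
Proof.
move=> adm r3; case: (adm) => ck cl k1 l1 A1.
have := avg_bounded (src k l A) 20^-1 r (src_continuous _ _ _ adm) r3.
move=> H; apply: le_trans (H _) _ => [x|]; [|lra].
by apply: source_bound => //; exact: clamp2_bound.
Qed.

(** The factor 3 is the greatest distance from 1 within [[-2, 2]]. *)
Lemma prim_dist (F f : R -> R) (C r : R) :
  (forall x : R, -3 < x < 3 -> is_derive x 1 F (f x)) ->
  (forall x, `|f x| <= C) -> - 2 <= r <= 2 -> `|F r - F 1| <= C * 3.
Proof.
move=> dF fC r2; have C0 : 0 <= C by apply: le_trans (fC 0).
have [r1|/ltW r1] := leP r 1.
  rewrite distrC; apply: le_trans (derive_bounded r1 _ _) _.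
  - by move=> x xr; apply: dF; lra.
  - by move=> x _; exact: fC.
  - by rewrite ler_wpM2l//; lra.
apply: le_trans (derive_bounded r1 _ _) _.
- by move=> x xr; apply: dF; lra.
- by move=> x _; exact: fC.
- by rewrite ler_wpM2l//; lra.
Qed.

Lemma slope_bound k l A s : admissible k l A -> `|slope k l s| <= 1000^-1.
Proof.
move=> [_ _ k1 l1 _].
have := normM_le _ _ _ _ (near1_norm _ (l1 s)) (strain_rate_bound _ _ (clamp2_bound s) (k1 s)).
rewrite /slope; lra.
Qed.

Lemma new_admissible k l A : admissible k l A ->
  admissible (newk k l A) (newl k l) (newA k l A).
Proof.
move=> adm; have one3 : -3 < (1 : R) < 3 by lra.
have N1 : `|avg (src k l A) 1| <= 100^-1 := avg_src_bound _ _ _ _ adm one3.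
have cs := src_continuous _ _ _ adm.
have dp := is_derive_prim _ (slope_continuous _ _ _ adm).
split=> [s|s|r|r|].
- apply: continuous_atB (continuous_at_cst _ _).
  apply: continuous_atD; first exact: continuous_at_cst.
  apply: continuous_comp; first exact: clamp_continuous.
  by apply: avg_continuous => //; exact: clamp2_in_domain.
- apply: continuous_atB (continuous_at_cst _ _).
  apply: continuous_atD; first exact: continuous_at_cst.
  apply: continuous_comp; first exact: clamp_continuous.
  exact: (is_derive_continuous (dp _ (clamp2_in_domain s))).
- have := avg_src_bound _ _ _ _ adm (clamp2_in_domain r); rewrite /newk.
  by move: N1 ks_bound; rewrite !ler_norml; lra.
- have := prim_dist _ _ _ _ dp (fun s => slope_bound _ _ _ s adm) (clamp2_bound r).
  rewrite /newl !ler_norml; lra.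
- by move: N1 ks_bound; rewrite /newA ler_norml; lra.
Qed.

(** The actual constants are [2 / 100] for [k], [3 / 1000] for [l] and [5 / 300] for [A], all well
    below [1 / 2]. *)
Lemma new_contraction k l A k' l' A' d :
  admissible k l A -> admissible k' l' A' ->
  (forall r, `|k r - k' r| <= d) -> (forall r, `|l r - l' r| <= d) ->
  `|A - A'| <= d ->
  [/\ forall r, `|newk k l A r - newk k' l' A' r| <= d / 2,
      forall r, `|newl k l r - newl k' l' r| <= d / 2 &
      `|newA k l A - newA k' l' A'| <= d / 2].
Proof.
move=> adm adm' kd ld Ad.
have d0 : 0 <= d by apply: le_trans Ad.
have one3 : -3 < (1 : R) < 3 by lra.
have cs := src_continuous _ _ _ adm; have cs' := src_continuous _ _ _ adm'.
have avd r : -3 < r < 3 ->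
    `|avg (src k l A) r - avg (src k' l' A') r| <= d / 100.
  move=> r3; apply: (@le_trans _ _ (20^-1 * d / 5)); last lra.
  apply: avg_dist => // x _; case: adm adm' => _ _ ? ? ? [_ _ ? ? ?].
  by apply: source_dist => //; exact: clamp2_bound.
have avd1 := avd _ one3.
split=> [r|r|].
- have := avd _ (clamp2_in_domain r); move: avd1; rewrite /newk !ler_norml; lra.
- have := @prim_dist (prim (slope k l) - prim (slope k' l'))
    (fun x => slope k l x - slope k' l' x) (1000^-1 * d) (clamp 2 r).
  rewrite /newl !fctE => H.
  have : `|prim (slope k l) (clamp 2 r) - prim (slope k' l') (clamp 2 r) -
     (prim (slope k l) 1 - prim (slope k' l') 1)| <= 1000^-1 * d * 3.
    apply: H => [x|x|]; last exact: clamp2_bound.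
      have := is_derive_prim _ (slope_continuous _ _ _ adm) x.
      have := is_derive_prim _ (slope_continuous _ _ _ adm') x.
      by move=> h' h x3; apply: is_deriveB; [exact: h|exact: h'].
    case: adm adm' => _ _ k1 l1 _ [_ _ k1' l1' _]; rewrite /slope.
    have := distM_le _ _ _ _ _ _ _ _ (near1_norm _ (l1 x))
      (strain_rate_bound _ _ (clamp2_bound x) (k1' x)) (ld x)
      (strain_rate_dist _ _ _ _ (clamp2_bound x) (kd x)); lra.
  rewrite !ler_norml; lra.
- by move: avd1; rewrite /newA !ler_norml; lra.
Qed.

Lemma uniformly_approximable_continuous (f : R -> R) :
  (forall e, 0 < e -> exists2 z : R -> R, continuous z &
     forall r, `|z r - f r| <= e) -> continuous f.
Proof.
move=> H x; apply/cvgrPdist_le => e e0.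
have [z cz zf] := H (e / 3) (divr_gt0 e0 (ltr0Sn _ _)).
have /cvgrPdist_le /(_ _ (divr_gt0 e0 (ltr0Sn _ 2))) := cz x.
apply: filterS => r; have := zf x; have := zf r.
rewrite !ler_norml; lra.
Qed.

Lemma profile_equations : exists k l A,
  [/\ admissible k l A, k 1 = ks, l 1 = 1,
      forall r, - 2 < r < 2 -> is_derive r 1 (fun x => x ^+ 5 * k x)
        (r ^+ 4 * (3 * A + source r (k r) (l r) A))
    & forall r, - 2 < r < 2 -> is_derive r 1 l
        (l r * strain_rate r (k r))].
Proof.
(* The triple is stored as one function: the first [R] indexes [k], the second [l], and [unit] holds
   [A]. *)
pose I := (R + (R + unit))%type.
pose kk (x : I -> R) r := x (inl r).
pose ll (x : I -> R) r := x (inr (inl r)).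
pose aa (x : I -> R) := x (inr (inr tt)).
pose P : set (I -> R) := [set x | admissible (kk x) (ll x) (aa x)].
pose T (x : I -> R) (i : I) : R := match i with
  | inl r => newk (kk x) (ll x) (aa x) r
  | inr (inl r) => newl (kk x) (ll x) r
  | inr (inr _) => newA (kk x) (ll x) (aa x) end.
pose x0 (i : I) : R := match i with inr (inr _) => 2 | _ => 1 end.
have c1 : continuous (fun _ : R => 1 : R) by move=> z; exact: cvg_cst.
have Px0 : P x0.
  by split=> // [r|r|]; rewrite /kk /ll /aa /= ?subrr ?normr0//; lra.
have PT x : P x -> P (T x) by exact: new_admissible.
have [|||x Px Tx] := @uniform_half_contraction R I P T x0 2 Px0 PT.
- move=> x H.
  have bd (i : I) (a b : R) : (forall z, P z -> a <= z i <= b) -> a <= x i <= b.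
    move=> Hz; apply/andP; split; apply/ler_addgt0Pr => e e0;
      have [z /Hz] := H e e0; move=> + /(_ i); rewrite ler_norml; lra.
  split=> [||r|r|].
  + apply: uniformly_approximable_continuous => e /H[z [cz _ _ _ _] zx].
    by exists (kk z) => // r; exact: zx.
  + apply: uniformly_approximable_continuous => e /H[z [_ cz _ _ _] zx].
    by exists (ll z) => // r; exact: zx.
  + have := bd (inl r) 2^-1 (3 / 2); rewrite /kk ler_norml => b.
    suff : 2^-1 <= x (inl r) <= 3 / 2 by lra.
    by apply: b => z [_ _ /(_ r) + _ _]; rewrite /kk ler_norml; lra.
  + have := bd (inr (inl r)) 2^-1 (3 / 2); rewrite /ll ler_norml => b.
    suff : 2^-1 <= x (inr (inl r)) <= 3 / 2 by lra.
    by apply: b => z [_ _ _ /(_ r) + _]; rewrite /ll ler_norml; lra.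
  + by apply: bd => z [].
- have [_ _ h1 h2 h3] := PT _ Px0.
  move=> [r|[r|[]]].
  + by have := h1 r; rewrite /kk /= !ler_norml; lra.
  + by have := h2 r; rewrite /ll /= !ler_norml; lra.
  + by move: h3; rewrite /aa /= !ler_norml; lra.
- move=> x y d Px Py xyd.
  have [h1 h2 h3] := new_contraction _ _ _ _ _ _ _ Px Py
    (fun r => xyd (inl r)) (fun r => xyd (inr (inl r))) (xyd (inr (inr tt))).
  by move=> [r|[r|[]]]; [exact: h1|exact: h2|exact: h3].
have ke r : kk x r = newk (kk x) (ll x) (aa x) r by rewrite [LHS]/kk -Tx.
have lE r : ll x r = newl (kk x) (ll x) r by rewrite [LHS]/ll -Tx.
have ae : aa x = newA (kk x) (ll x) (aa x) by rewrite [LHS]/aa -Tx.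
move: Px ke lE ae; rewrite /P /=; move: (kk x) (ll x) (aa x) => k l A.
move=> adm ke lE ae; exists k, l, A.
have cid r : - 2 < r < 2 -> clamp 2 r = r.
  by move=> ?; rewrite clamp_id//; lra.
have near2 r : - 2 < r < 2 -> \forall x \near r, - 2 < x < 2.
  move=> r2; have rI : r \in `](- 2), 2[ by rewrite in_itv.
  by apply: filterS (near_in_itvoo rI) => z; rewrite in_itv.
split=> // [||r r2|r r2].
- by rewrite ke /newk cid ?addrK//; lra.
- by rewrite lE /newl cid ?addrK//; lra.
- have r3 : -3 < r < 3 by lra.
  have d1 := is_derive_pow5_avg _ _ (src_continuous _ _ _ adm) r3.
  (* At the fixed point [ks - avg _ 1 = 3 A / 5], so near [r] the function [x^5 k] is [3 A / 5 x^5]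
     plus [x^5] times the average. *)
  have d2 := is_derive_pow5 (3 * A) r.
  have -> : r ^+ 4 * (3 * A + source r (k r) (l r) A) =
      3 * A * r ^+ 4 + r ^+ 4 * src k l A r.
    by rewrite /src cid//; ring.
  apply: near_eq_is_derive (is_deriveD d2 d1).
  apply: filterS (near2 _ r2) => z z2.
  by rewrite !fctE ke /newk cid// {1}ae /newA; field.
- have r3 : -3 < r < 3 by lra.
  have dp := is_derive_prim _ (slope_continuous _ _ _ adm) r r3.
  have -> : l r * strain_rate r (k r) = 0 + slope k l r - 0.
    by rewrite /slope cid// add0r subr0.
  have dd := is_deriveB (is_deriveD (is_derive_cst (1 : R) r 1) dp)
    (is_derive_cst (prim (slope k l) 1) r 1).
  apply: near_eq_is_derive dd; apply: filterS (near2 _ r2) => z z2.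
  by rewrite !fctE lE /newl cid.
Qed.

End FixedPoint.

(** * The energy at the identity *)

Section EnergyAtIdentity.
Context {R : realType} (W : 'M[R]_3 -> R).
Hypotheses (WC1 : C1_on_GLplus W) (Wobj : objective W) (Wiso : isotropic W).
Hypotheses (Whom : homogeneous_m1 W) (W1 : W 1%:M = 1).

Let I3 : 'M[R]_3 := 1%:M.

Lemma differentiable_at_identity : differentiable W I3.
Proof. by apply: (WC1 _ _).1; rewrite det1. Qed.

Lemma is_derive_line (E : 'M[R]_3) :
  is_derive (0 : R) 1 (fun t : R => W (t *: E + I3)) ('d W I3 E).
Proof.
have dW := differentiable_at_identity.
have dE := @diff_derivable _ _ _ _ _ E dW.
split; first by move/derivable1P : dE.
rewrite -deriveE// /derive; congr (lim _).
by under eq_fun do rewrite /= addr0 scale0r add0r [_ *: 1]mulr1.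
Qed.

(** A transposition matrix has determinant -1; its negative is a rotation because the dimension is
    odd. *)
Lemma swap_rotation (i : 'I_3) : i != 0 ->
  is_rotation (- tperm_mx 0 i : 'M[R]_3).
Proof.
move=> i0; split.
  by rewrite linearN /= mulNmx mulmxN opprK tr_tperm_mx -perm_mxM tperm2 perm_mx1.
rewrite -scaleN1r detZ det_perm odd_tperm eq_sym i0.
by rewrite -exprD -signr_odd.
Qed.

Lemma swap_conj (i : 'I_3) :
  tperm_mx 0 i *m delta_mx 0 0 *m (tperm_mx 0 i)^T = delta_mx i i :> 'M[R]_3.
Proof.
rewrite tr_perm_mx -col_permE -row_permE; apply/matrixP => a b; rewrite !mxE.
have swap (c : 'I_3) : (tperm 0 i c == 0) = (c == i).
  by rewrite -{2}(tpermR 0 i) (inj_eq perm_inj).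
by rewrite !swap.
Qed.

Lemma stretch_diag (h : R) : h *: delta_mx 0 0 + I3 =
  diag_mx (\row_j (if j == 0 then h + 1 else 1)).
Proof.
apply/matrixP => a b; rewrite !mxE.
have [<-|ab] := eqVneq a b; last first.
  rewrite mulr0n addr0; case: (eqVneq a 0) => [a0|_] /=; last by rewrite mulr0.
  by rewrite -a0 eq_sym (negbTE ab) mulr0.
by rewrite andbb; case: eqVneq => _ /=; rewrite ?mulr1// mulr0 add0r.
Qed.

Lemma det_stretch (h : R) : \det (h *: delta_mx 0 0 + I3) = h + 1.
Proof.
by rewrite stretch_diag det_diag !big_ord_recl big_ord0 !mxE /= !mulr1.
Qed.

(** Conjugation by a rotation exchanging the axes 0 and [i]: objectivity removes the left factor,
    isotropy the right one. The bound on [h] keeps the determinant [h + 1] positive. *)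
Lemma W_stretch (h : R) (i : 'I_3) : -1 < h ->
  W (h *: delta_mx i i + I3) = W (h *: delta_mx 0 0 + I3).
Proof.
move=> h1; have [->//|i0] := eqVneq i 0.
have rO := swap_rotation i i0; set O := - _ in rO; case: (rO) => OO dO.
have rOT : is_rotation O^T.
  by split; rewrite ?det_tr// trmxK; exact: (mulmx1C OO).
have detF : 0 < \det (h *: delta_mx 0 0 + I3) by rewrite det_stretch; lra.
have <- : O *m (h *: delta_mx 0 0 + I3) *m O^T = h *: delta_mx i i + I3.
  rewrite mulmxDr mulmxDl -scalemxAr -scalemxAl mulmx1 OO -(swap_conj i).
  by rewrite /O linearN /= !mulNmx mulmxN opprK.
by rewrite Wiso ?Wobj// det_mulmx dO mul1r.
Qed.

Lemma near0_gtN1 : \forall h \near (0 : R), -1 < h.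
Proof.
have zI : (0 : R) \in `](-1), 1[ by rewrite in_itv /=; lra.
by apply: filterS (near_in_itvoo zI) => h; rewrite in_itv => /andP[].
Qed.

Lemma diff_identity_diag (i : 'I_3) :
  'd W I3 (delta_mx i i) = 'd W I3 (delta_mx 0 0).
Proof.
have [_ <-] := is_derive_line (delta_mx 0 0).
have [_ <-] := is_derive_line (delta_mx i i).
apply: near_eq_derive.
by apply: filterS near0_gtN1 => h /W_stretch ->.
Qed.

(** Homogeneity makes [W] equal to [(h + 1)^-1] at [h + 1] times the identity. *)
Lemma diff_identity_identity : 'd W I3 I3 = -1.
Proof.
have [_ <-] := is_derive_line I3.
have dinv : is_derive (0 : R) 1 (fun h : R => (h + 1)^-1) (- 1).
  have d1 : is_derive (0 : R) 1 (fun h : R => h + 1) 1.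
    rewrite -[X in is_derive _ _ _ X]addr0.
    exact: (is_deriveD (is_derive_id _ _) (is_derive_cst _ _ _)).
  have n0 : (0 : R) + 1 != 0 by rewrite add0r oner_neq0.
  apply: is_derive_eq (@is_deriveV R (fun h : R => h + 1) 0 1 1 n0 d1) _.
  by rewrite add0r expr1n invr1 scaleN1r.
have [_ <-] := dinv; apply: near_eq_derive.
apply: filterS near0_gtN1 => h h1.
rewrite -[X in _ + X]scale1r -scalerDl Whom ?det1// ?W1 ?mulr1//.
by rewrite -ltrBlDr sub0r.
Qed.

(** The identity is the sum of the three [delta_mx i i], on which the differential takes equal
    values with total -1. This yields [g' 1 = -1/3], hence [h 1 = 0]. *)
Lemma diff_identity_e1 : 'd W I3 (delta_mx 0 0) = - 3^-1.
Proof.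
have : 'd W I3 I3 = \sum_(i < 3) 'd W I3 (delta_mx i i).
  rewrite -linear_sum /=; congr ('d W I3 _).
  by rewrite /I3 mx1_sum_delta.
under eq_bigr do rewrite diff_identity_diag.
rewrite diff_identity_identity sumr_const card_ord => h3.
move: h3; set x := 'd W I3 _; rewrite mulrSr mulr2n => h3.
lra.
Qed.

Lemma outer_e1 : outer (@e1 R) = delta_mx 0 0.
Proof. by rewrite /outer /e1 trmx_delta mul_delta_mx. Qed.

Lemma g_of1 : g_of W 1 = 1.
Proof. by rewrite /g_of subrr scale0r addr0. Qed.

Lemma is_derive_g_of1 : is_derive (1 : R) 1 (g_of W) (- 3^-1).
Proof.
have d1 : is_derive (1 : R) 1 (fun y : R => y - 1) 1.
  rewrite -[X in is_derive _ _ _ X]subr0.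
  exact: (is_deriveB (is_derive_id _ _) (is_derive_cst _ _ _)).
have -> : g_of W = (fun t : R => W (t *: delta_mx 0 0 + I3)) \o (fun y => y - 1).
  by apply/funext => y; rewrite /g_of outer_e1 /= addrC.
rewrite -[X in is_derive _ _ _ X]mulr1; apply: is_derive1_comp d1.
rewrite subrr -diff_identity_e1; exact: is_derive_line.
Qed.

End EnergyAtIdentity.

(** * Solution of the profile equation *)

Section Pointwise.
Context {R : realType}.
Implicit Types (f g : R -> R) (x r C : R).

Lemma is_derive_mul f g x (df dg : R) : is_derive x 1 f df ->
  is_derive x 1 g dg ->
  is_derive x 1 (fun z => f z * g z) (f x * dg + g x * df).
Proof. exact: is_deriveM. Qed.

Lemma is_derive_add_cst (c : R) f x (df : R) : is_derive x 1 f df ->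
  is_derive x 1 (fun z => c + f z) df.
Proof.
by move=> d; rewrite -[df]add0r; apply: is_deriveD.
Qed.

Lemma is_derive_pow n x :
  is_derive x 1 (fun z : R => z ^+ n) (n%:R * x ^+ n.-1).
Proof.
have -> : (fun z : R => z ^+ n) = (@id R) ^+ n.
  by apply/funext => z; rewrite !fctE.
apply: is_derive_eq (is_deriveX n (is_derive_id x 1)) _.
by rewrite /GRing.scale /= mulr1.
Qed.

Lemma is_derive_inv f x (df : R) : f x != 0 -> is_derive x 1 f df ->
  is_derive x 1 (fun z => (f z)^-1) (- df / f x ^+ 2).
Proof.
move=> fx d; apply: is_derive_eq (is_deriveV fx d) _.
by rewrite /GRing.scale /= mulNr mulrC mulNr.
Qed.

(** Meant for [y] at 0, where the equation controls only [r^5 k] and gives no derivative of [k]. *)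
Lemma is_derive_quadratic f C :
  (forall z, -1 < z < 1 -> `|f z - f 0| <= C * z ^+ 2) ->
  is_derive (0 : R) 1 f 0.
Proof.
move=> fC; apply/is_derive1_caratheodory.
exists (fun z => (f z - f 0) / z); split; last by rewrite subrr mul0r.
  by move=> z; rewrite subr0; case: (eqVneq z 0) => [->|z0];
    rewrite ?subrr ?mul0r// divfK.
rewrite /prop_for /continuous_at /= subrr mul0r.
apply/cvgr0Pnorm_le => e e0.
have C0 : 0 < `|C| + 1 by rewrite ltr_wpDl.
apply/nbhs_ballP; exists (Num.min 1 (e / (`|C| + 1))) => /=.
  by rewrite lt_min ltr01 divr_gt0.
move=> z; rewrite /ball /= sub0r normrN lt_min => /andP[z1].
rewrite ltr_pdivlMr// => ze.
have [->|z0] := eqVneq z 0; first by rewrite invr0 mulr0 normr0 ltW.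
rewrite normrM normfV ler_pdivrMr ?normr_gt0//.
have zI : -1 < z < 1 by move: z1; rewrite ltr_norml.
apply: le_trans (fC _ zI) _; rewrite -(real_normK (num_real z)) expr2 mulrA.
rewrite ler_wpM2r//; apply: le_trans (ltW ze); rewrite mulrC ler_wpM2l//.
by rewrite (le_trans (ler_norm _))// lerDl.
Qed.

Lemma powR_cube_inv (s : R) : 0 < s -> (s ^+ 3) `^ (- 3^-1) = s^-1.
Proof.
move=> s0; rewrite -(powR_mulrn 3 (ltW s0)) -powRrM mulrN divff//.
by rewrite powR_inv1// ltW.
Qed.

Lemma near_in_oo {a b x : R} : a < x < b -> \forall z \near x, a < z < b.
Proof.
move=> xab; have xI : x \in `]a, b[ by rewrite in_itv.
by apply: filterS (near_in_itvoo xI) => z; rewrite in_itv.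
Qed.

End Pointwise.

Section Profile.
Context {R : realType}.
Variables (g g2 : R -> R).
Let g1 : R -> R := derive1 g.
Hypothesis dg : forall y : R, 2^-1 <= y <= 3 / 2 -> is_derive y 1 g (g1 y).
Hypothesis dg1 : forall y : R, 2^-1 <= y <= 3 / 2 -> is_derive y 1 g1 (g2 y).
Hypothesis g2_large : forall y : R, 2^-1 <= y <= 3 / 2 -> 2500 <= g2 y.
Hypothesis g_1 : g 1 = 1.
Hypothesis g1_1 : g1 1 = - 3^-1.

Let h (y : R) := (4 - y) * g1 y + g y.

Lemma is_derive_h (y : R) : 2^-1 <= y <= 3 / 2 ->
  is_derive y 1 h ((4 - y) * g2 y).
Proof.
move=> yI; have d4 : is_derive y 1 (fun z : R => 4 - z) (-1).
  rewrite -[X in is_derive _ _ _ X]sub0r.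
  exact: (is_deriveB (is_derive_cst _ _ _) (is_derive_id _ _)).
apply: is_derive_eq (is_deriveD (is_derive_mul _ _ _ _ _ d4 (dg1 _ yI)) (dg _ yI)) _.
by ring.
Qed.

(** [g1] rises from [-1/3] with slope at least 2500, so it vanishes within [1 / 7500] of 1. Up to
    that point [|g1| <= 1], which keeps [g] within [1 / 7500] of [g 1 = 1]. *)
Lemma traction_free_strain : exists ys : R,
  [/\ 1 <= ys <= 3 / 2, g1 ys = 0 & 99 / 100 <= g ys <= 101 / 100].
Proof.
have g1inc (a b : R) : 1 <= a -> a <= b -> b <= 3 / 2 ->
    2500 * (b - a) <= g1 b - g1 a.
  move=> a1 ab b3.
  by apply: (derive_lower_bound ab) => x /andP[? ?]; [apply: dg1|apply: g2_large]; lra.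
have hi : 0 <= g1 (3 / 2) by have := g1inc 1 (3 / 2); rewrite g1_1; lra.
have le13 : (1 : R) <= 3 / 2 by lra.
have cont : {within `[1, 3 / 2], continuous g1}.
  by apply: is_derive_continuous_within => x /andP[? ?]; apply: dg1; lra.
have [|ys] := @IVT R g1 1 (3 / 2) 0 le13 cont.
  by rewrite ge_min le_max hi orbT g1_1 andbT oppr_le0 invr_ge0 ler0n.
rewrite in_itv /= => ysI ys0; exists ys; split=> //.
case/andP: (ysI) => ys1 ys3.
have ysmall : ys - 1 <= 1 / 7500.
  by have := g1inc 1 ys; rewrite g1_1 ys0; lra.
have := @derive_bounded R g g1 1 ys 1 ys1; rewrite g_1 mul1r => H.
suff : `|g ys - 1| <= ys - 1 by rewrite ler_norml; lra.
apply: H => x /andP[x1 xy]; first by apply: dg; lra.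
have := g1inc 1 x; have := g1inc x ys; rewrite ys0 g1_1 ler_norml.
by clear ysmall; lra.
Qed.

Lemma homologous_profile (kappa mu : R) : 0 < kappa ->
  `|mu * Num.sqrt kappa| <= 1000^-1 ->
  exists (rho : R) (phi : R -> R),
    0 < rho /\
    (forall r : R, 0 <= r <= 1 ->
       derivable phi r 1 /\ derivable (derive1 phi) r 1 /\
       0 <= phi r /\ 0 < derive1 phi r) /\
    phi 0 = 0 /\ derive1n 2 phi 0 = 0 /\
    (forall r : R, 0 < r <= 1 ->
       derivable (flux g phi) r 1 /\
       (phi r) ^+ 2 / r ^+ 5 * derive1 (flux g phi) r
         + phi r / r ^+ 2 * g (yfun phi r)
       = (kappa * rho + mu * (lam phi r) ^+ 3)
           * rho `^ (- 3^-1) * phi r) /\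
    g1 (yfun phi 1) = 0 /\
    phi 1 = 1.
Proof.
move=> kappa0 beta_small.
have h1 : h 1 = 0 by rewrite /h g1_1 g_1; lra.
(* Here [4 - y >= 5 / 2], and [5 / 2] times 2500 is 6250. *)
have hlarge (y : R) : 2^-1 <= y <= 3 / 2 -> 6000 <= (4 - y) * g2 y.
  by move=> yI; have := g2_large _ yI; nra.
have L0 : (0 : R) < 6000 by lra.
have [psi [psiL psiB hpsi0 psih0 dpsi0]] :=
  inverse_at_1 _ _ _ L0 is_derive_h hlarge h1.
(* 8 is a convenient bound for the arguments at which [psi] is used as an inverse: [|r^2 k| <= 6] on
   [(-2, 2)], and [g ys] is close to 1. *)
have lt8 (x : R) : `|x| <= 8 -> `|x| < 6000 / 2.
  by move=> x8; lra.
have hpsi x (x8 : `|x| <= 8) := hpsi0 x (lt8 x x8).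
have psih x xI (x8 : `|h x| <= 8) := psih0 x xI (lt8 _ x8).
have dpsi x (x8 : `|x| <= 8) := dpsi0 x (lt8 x x8).
clear hpsi0 psih0 dpsi0 lt8 L0.
have psi0 : psi 0 = 0.
  rewrite -{1}h1 psih ?subrr ?h1 ?normr0 ?ler0n//; lra.
have [ys [ysI g1ys ksB]] := traction_free_strain.
have [k [l [A [[ck cl k1 l1 AB] kk1 ll1 dk dl]]]] :=
  profile_equations psi (g ys) _ psiL psi0 ksB beta_small.
have ks8 : `|g ys| <= 8 by move: ksB; rewrite ler_norml; lra.
clear beta_small ksB.
pose y r := 1 + psi (r ^+ 2 * k r).
pose phi r := r * l r.
(* The coefficient [(kappa rho + mu l^3) rho^(-1/3)] of the right-hand side, written before [rho] is
   known. *)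
pose a r := A + mu * Num.sqrt kappa / Num.sqrt A * l r ^+ 3.
have sA0 : 0 < Num.sqrt A by rewrite sqrtr_gt0; lra.
have sAn0 : Num.sqrt A != 0 by rewrite gt_eqF.
have y0 : y 0 = 1 by rewrite /y expr0n mul0r psi0 addr0.
have yI (r : R) : 2^-1 <= y r <= 3 / 2.
  by have := psiB (r ^+ 2 * k r); rewrite /y ler_norml; lra.
have g20 (r : R) : g2 (y r) != 0.
  by apply: lt0r_neq0; have := g2_large _ (yI r); lra.
have y40 (r : R) : 4 - y r != 0 by apply: lt0r_neq0; have := yI r; lra.
have lpos (r : R) : 0 < l r by have := l1 r; rewrite ler_norml; lra.
have kB (r : R) : `|k r| <= 3 / 2 by have := k1 r; rewrite !ler_norml; lra.
have xB (r : R) : -2 < r < 2 -> `|r ^+ 2 * k r| <= 8.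
  move=> r2; have r4 : `|r ^+ 2| <= 4 by rewrite ger0_norm ?sqr_ge0//; nra.
  by have := normM_le _ _ _ _ r4 (kB r); lra.
have hy (r : R) : -2 < r < 2 -> h (y r) = r ^+ 2 * k r by move=> /xB /hpsi.
have dphi (r : R) : -2 < r < 2 -> is_derive r 1 phi (l r * y r).
  move=> r2; apply: is_derive_eq (is_derive_mul _ _ _ _ _ (is_derive_id r 1) (dl r r2)) _.
  have [->|r0] := eqVneq r 0; first by rewrite y0 mul0r add0r.
  by rewrite /strain_rate /y; field.
have phi' (r : R) : -2 < r < 2 -> derive1 phi r = l r * y r.
  by move=> /dphi d; rewrite derive1E derive_val.
have dy (r : R) : -2 < r < 2 -> r != 0 ->
    is_derive r 1 y (r * (a r - k r) / g2 (y r)).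
  move=> r2 r0.
  have r30 : r ^+ 3 != 0 by rewrite expf_neq0.
  (* Writing [r^2 k] as [r^5 k] times [r^-3] gives the derivative [r (4 - y) (a - k)]; its factor
     [4 - y] cancels against the one in [psi' = 1 / ((4 - y) g'')]. *)
  have dH : is_derive r 1 (fun x => x ^+ 2 * k x)
      (r * ((4 - y r) * (a r - k r))).
    have d := is_derive_mul _ _ _ _ _ (dk r r2)
      (is_derive_inv (fun z : R => z ^+ 3) r _ r30 (is_derive_pow 3 r)).
    apply: near_eq_is_derive; last first.
      apply: is_derive_eq d _.
      by rewrite /source /a /y /=; field; rewrite r0 sAn0.
    near=> x; have x0 : x != 0 by near: x; exact: (cvgr_neq0 _ cvg_id r0).
    by field.
  have dp := dpsi _ (xB _ r2); rewrite -/(y r) in dp.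
  have dc := @is_derive1_comp R psi (fun x => x ^+ 2 * k x) r _ _ dp dH.
  apply: is_derive_eq (is_derive_add_cst 1 _ _ _ dc) _.
  by field; rewrite g20 y40.
have dy0 : is_derive (0 : R) 1 y 0.
  apply: (@is_derive_quadratic _ _ 1) => z zI.
  have := psiL (z ^+ 2 * k z) 0; rewrite psi0 !subr0 => pz.
  have -> : y z - y 0 = psi (z ^+ 2 * k z) by rewrite y0 /y; ring.
  apply: le_trans pz _; rewrite normrM [`|z ^+ 2|]ger0_norm ?sqr_ge0//.
  have := ler_wpM2l (sqr_ge0 z) (kB z); have := sqr_ge0 z; lra.
(* At 0 the derivative of [y] comes from [dy0] instead of [dy]; the clause on [r = 0] records its
   value for [phi'' 0]. *)
have dphi' (r : R) : -2 < r < 2 -> exists dyr : R, is_derive r 1 (derive1 phi)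
    (l r * dyr + y r * (l r * strain_rate psi r (k r))) /\ (r = 0 -> dyr = 0).
  move=> r2.
  have [dyr [dyP dy00]] : exists dyr : R, is_derive r 1 y dyr /\ (r = 0 -> dyr = 0).
    have [r0|r0] := eqVneq r 0; first by exists 0; rewrite r0.
    by exists (r * (a r - k r) / g2 (y r)); split;
      [exact: dy|move=> re; rewrite re eqxx in r0].
  exists dyr; split=> //; have d := is_derive_mul _ _ _ _ _ (dl r r2) dyP.
  apply: near_eq_is_derive d; apply: filterS (near_in_oo r2) => z z2.
  by rewrite phi'.
have lamE (r : R) : r != 0 -> lam phi r = l r.
  by move=> r0; rewrite /lam (negbTE r0) /phi mulrC mulKf.
have yE (r : R) : -2 < r < 2 -> r != 0 -> yfun phi r = y r.
  move=> r2 r0; rewrite /yfun lamE// phi'// mulrC mulKf//.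
  by rewrite gt_eqF.
have sk0 : 0 < Num.sqrt kappa by rewrite sqrtr_gt0.
have A0 : 0 <= A by lra.
(* [s] is [rho^(1/3) = sqrt (A / kappa)]: the density is recovered from the [A] of the fixed
   point. *)
have [s [s0 s2 sB]] : exists s, [/\ 0 < s, kappa * s ^+ 2 = A &
    mu * Num.sqrt kappa / Num.sqrt A = mu / s].
  exists (Num.sqrt A / Num.sqrt kappa); split; first exact: divr_gt0.
    rewrite -{1}(sqr_sqrtr (ltW kappa0)) -[RHS](sqr_sqrtr A0).
    by field; rewrite gt_eqF.
  by field; rewrite sAn0 gt_eqF.
exists (s ^+ 3), phi; split; first by rewrite exprn_gt0.
split.
  move=> r /andP[r0 r1]; have r2 : -2 < r < 2 by lra.
  have [dyr [d2 _]] := dphi' _ r2; have d1 := dphi _ r2.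
  split; first by case: d1.
  split; first by case: d2.
  split; first by rewrite mulr_ge0// ltW.
  by rewrite phi'// mulr_gt0//; have := yI r; lra.
have z2 : -2 < (0 : R) < 2 by lra.
split; first by rewrite /phi mul0r.
split.
  have [dyr [d2 d20]] := dphi' _ z2.
  rewrite /derive1n /= derive1E derive_val d20// /strain_rate invr0.
  by rewrite !mulr0 addr0.
split.
  move=> r /andP[r0 r1]; have r2 : -2 < r < 2 by lra.
  have rn0 : r != 0 by rewrite gt_eqF.
  have ln0 : l r != 0 by rewrite gt_eqF.
  (* Near [r] the flux is [r^3 / l] times [g1 y]. By [l' = l (y - 1) / r], the derivative of
     [r^3 / l] is [(4 - y) r^2 / l], and [g''] cancels against the denominator of [y']. *)
  have dfl : is_derive r 1 (flux g phi)
    (r ^+ 2 / l r * ((4 - y r) * g1 (y r) + r ^+ 2 * (a r - k r))).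
    have d1 := @is_derive1_comp R g1 y r _ _ (dg1 _ (yI r)) (dy _ r2 rn0).
    have d2 := is_derive_mul _ _ _ _ _ (is_derive_pow 3 r)
      (is_derive_inv l r _ ln0 (dl r r2)).
    apply: near_eq_is_derive (is_derive_eq (is_derive_mul _ _ _ _ _ d2 d1) _).
      have rI : 0 < r < 2 by rewrite r0; case/andP: r2.
      apply: filterS (near_in_oo rI) => z zI.
      have zn0 : z != 0 by case/andP: zI => ? _; rewrite gt_eqF.
      have z2' : -2 < z < 2 by lra.
      have lz0 : l z != 0 by rewrite gt_eqF.
      rewrite /flux (yE _ z2' zn0).
      by rewrite /phi -/g1 /=; field; rewrite zn0 lz0.
    by rewrite /strain_rate /= /y; field; rewrite rn0 ln0 g20.
  split; first by case: dfl.
  rewrite [derive1 (flux _ _) r]derive1E derive_val yE// lamE// powR_cube_inv//.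
  (* By [h y = r^2 k], the sum [(4 - y) g1 y + g y + r^2 (a - k)] reduces to [r^2 a]. *)
  have hyr := hy _ r2; rewrite /h in hyr.
  have -> : (kappa * s ^+ 3 + mu * l r ^+ 3) * s^-1 * phi r = a r * phi r.
    by congr (_ * _); rewrite /a sB -s2; field; rewrite gt_eqF.
  have -> : g (y r) = r ^+ 2 * k r - (4 - y r) * g1 (y r) by rewrite -hyr; ring.
  by rewrite /phi; field; rewrite rn0 ln0.
have o2 : -2 < (1 : R) < 2 by lra.
split; last by rewrite /phi ll1 mulr1.
(* The end is traction-free because [k 1 = g ys = h ys], so that [1 + psi (k 1) = ys]. *)
rewrite yE ?oner_neq0// /y kk1 expr1n mul1r.
have hys : h ys = g ys by rewrite /h g1ys mulr0 add0r.
rewrite -hys psih; [by rewrite addrC subrK| lra |].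
by rewrite hys.
Unshelve. all: by end_near.
Qed.

End Profile.

(** With [M] the supremum, [g''] drops by at most [M / 2] on the interval, and
    [50 (50 + M) - M / 2 >= 2500] because [M >= 0]. *)
Lemma C3_pos_second_derivative_large {R : realType} (g : R -> R) : C3_pos g ->
  derive1n 2 g 1 >=
    50 * (50 + sup [set `|derive1n 3 g y| | y in [set y : R | `|y - 1| <= 2^-1]]) ->
  forall y, 2^-1 <= y <= 3 / 2 -> 2500 <= derive1n 2 g y.
Proof.
move=> C3; set S := [set _ | _ in _] => g2S y yI.
have dist1 (z : R) : (`|z - 1| <= 2^-1) = (2^-1 <= z <= 3 / 2).
  by rewrite ler_norml; apply/idP/idP; lra.
(* [sup] takes a default value on unbounded sets, so it bounds [g'''] only once continuity on a
   compact interval has made the set bounded. *)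
have [c cI cmax] : exists2 c, c \in `[2^-1, 3 / 2] &
    forall t, t \in `[2^-1, 3 / 2] -> `|derive1n 3 g t| <= `|derive1n 3 g c|.
  apply: EVT_max; first lra.
  apply: continuous_in_subspaceT => x /[!inE] /= /[!in_itv] /= xI.
  have x0 : 0 < x by lra.
  apply: (@continuous_comp _ _ _ (derive1n 3 g) (fun z : R => `|z|)).
    by have [_ [_ [_]]] := C3 _ x0.
  exact: norm_continuous.
have ubS : has_ubound S.
  exists `|derive1n 3 g c| => _ [z /= zI <-]; apply: cmax.
  by rewrite in_itv /= -dist1.
have g3M (z : R) : 2^-1 <= z <= 3 / 2 -> `|derive1n 3 g z| <= sup S.
  by rewrite -dist1 => zI; apply: ub_le_sup => //; exists z.
have dg2 (z : R) : 2^-1 <= z <= 3 / 2 ->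
    is_derive z 1 (derive1n 2 g) (derive1n 3 g z).
  move=> zI; have z0 : 0 < z by lra.
  have [_ [_ [d _]]] := C3 _ z0.
  by split; [exact: d|rewrite -derive1E -derive1nS].
have M0 : 0 <= sup S by apply: le_trans (g3M _ yI).
have : `|derive1n 2 g y - derive1n 2 g 1| <= sup S * 2^-1.
  have [y1|/ltW y1] := leP 1 y.
    apply: le_trans (@derive_bounded _ _ _ _ _ (sup S) y1 _ _) _.
    - by move=> z zI; apply: dg2; lra.
    - by move=> z zI; apply: g3M; lra.
    - by rewrite ler_wpM2l//; lra.
  rewrite distrC; apply: le_trans (@derive_bounded _ _ _ _ _ (sup S) y1 _ _) _.
  - by move=> z zI; apply: dg2; lra.
  - by move=> z zI; apply: g3M; lra.
  - by rewrite ler_wpM2l//; lra.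
move: g2S M0; clear.
move: (derive1n 2 g y) (derive1n 2 g 1) (sup S) => u v M.
by rewrite ler_norml; lra.
Qed.

Theorem theorem1 (R : realType) (G : R) (W : 'M[R]_3 -> R) :
  0 < G ->
  C1_on_GLplus W -> objective W -> isotropic W -> homogeneous_m1 W ->
  W 1%:M = 1 ->
  C3_pos (g_of W) ->
  derive1n 2 (g_of W) 1 >=
    50 * (50 + sup [set `|derive1n 3 (g_of W) y| | y in [set y : R | `|y - 1| <= 2^-1]]) ->
  exists mu0 : R, 0 < mu0 /\
    forall mu : R, -mu0 <= mu <= mu0 ->
      exists (rho : R) (phi : R -> R),
        0 < rho /\
        (forall r : R, 0 <= r <= 1 ->
           derivable phi r 1 /\ derivable (derive1 phi) r 1 /\
           0 <= phi r /\ 0 < derive1 phi r) /\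
        phi 0 = 0 /\ derive1n 2 phi 0 = 0 /\
        (forall r : R, 0 < r <= 1 ->
           derivable (flux (g_of W) phi) r 1 /\
           (phi r) ^+ 2 / r ^+ 5 * derive1 (flux (g_of W) phi) r
             + phi r / r ^+ 2 * g_of W (yfun phi r)
           = (4 * pi / 3 * G * rho + mu * (lam phi r) ^+ 3)
               * rho `^ (- 3^-1) * phi r) /\
        derive1 (g_of W) (yfun phi 1) = 0 /\
        phi 1 = 1.
Proof.
move=> G0 WC1 Wobj Wiso Whom W1 C3 g2large.
have kappa0 : 0 < 4 * pi / 3 * G by rewrite mulr_gt0 ?divr_gt0 ?mulr_gt0 ?pi_gt0.
have sk0 : 0 < Num.sqrt (4 * pi / 3 * G) by rewrite sqrtr_gt0.
(* This choice amounts to [|mu| sqrt kappa <= 1 / 1000], the smallness required of [beta] in the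
   fixed-point problem. *)
exists (1000^-1 / Num.sqrt (4 * pi / 3 * G)).
have c0 : (0 : R) < 1000^-1 by rewrite invr_gt0 ltr0n.
split; first exact: divr_gt0.
move=> mu mu_I; have mu_small : `|mu| <= 1000^-1 / Num.sqrt (4 * pi / 3 * G).
  by rewrite ler_norml.
have pos (y : R) : 2^-1 <= y <= 3 / 2 -> 0 < y by lra.
apply: (@homologous_profile R (g_of W) (derive1n 2 (g_of W))).
- move=> y /pos y0; have [d _] := C3 _ y0.
  by split; [exact: d|rewrite derive1E].
- move=> y /pos y0; have [_ [d _]] := C3 _ y0.
  by split; [exact: d|rewrite derive1nS derive1n1 -derive1E].
- exact: C3_pos_second_derivative_large C3 g2large.
- exact: g_of1.
- have d := is_derive_g_of1 _ WC1 Wobj Wiso Whom W1.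
  by rewrite derive1E derive_val.
- exact: kappa0.
- rewrite normrM [`|Num.sqrt _|](ger0_norm (sqrtr_ge0 _)).
  by rewrite -(ler_pdivlMr _ _ sk0).
Qed.
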